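(* Let $\Omega=\{1,2,3\}$ with counting measure $\mu$, and let $g_0$ and $\hat g_1$ be the probability vectors on $\Omega$ $$g_0=(0.40194407,\;0.47871677,\;0.11933916),\qquad \hat g_1=(0.07550977,\;0.67274530,\;0.25174493).$$ There exist convex, compact, disjoint sets $\mathcal{G}_0,\mathcal{G}_1$ of probability measures on $\Omega$ with $(g_0,\hat g_1)\in\mathcal{G}_0\times\mathcal{G}_1$ and with uniformly bounded likelihood ratios (that is, there are constants $0<a\le b<\infty$ such that for every $(G_0,G_1)\in\mathcal{G}_0\times\mathcal{G}_1$ the likelihood ratio $L$, given by the ratio of the probability vector of $G_1$ to that of $G_0$, satisfies $a\le L\le b$ at every point of $\Omega$) such that: (i) the pair $(g_0,\hat g_1)$ maximizes $D_u(G_0,G_1)$ over $(G_0,G_1)\in\mathcal{G}_0\times\mathcal{G}_1$ for every $u\in(0,1)$; (ii) the pair $(g_0,\hat g_1)$ does not minimize $D_f(G_0,G_1)$ over $(G_0,G_1)\in\mathcal{G}_0\times\mathcal{G}_1$ for the convex function $f(x)=(x-1.43448)_+=\max\{x-1.43448,0\}$; (iii) consequently, no finite-sample minimax robust (FMR) test exists for $\mathcal{G}_0,\mathcal{G}_1$.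
   Context: Probability measures on the finite set $\Omega$ are identified with their densities with respect to counting measure $\mu$ (probability vectors); densities are denoted by lower-case letters, so $g_j$ is the density of $G_j$. Compactness refers to the usual topology on $\mathbb{R}^3$. Chernoff functional: for $u\in(0,1)$, $D_u(G_0,G_1)=\int_\Omega g_1^{u}g_0^{1-u}\,d\mu=\sum_{i} g_{1,i}^{u}\,g_{0,i}^{1-u}$. $f$-divergence: for convex $f:(0,\infty)\to\mathbb{R}$ with $f(1)=0$, $D_f(G_0,G_1)=\int_\Omega f(g_1/g_0)\,g_0\,d\mu=\sum_i f(g_{1,i}/g_{0,i})\,g_{0,i}$. Single-sample minimax robustness (SMR): a pair $(\hat G_0,\hat G_1)\in\mathcal{G}_0\times\mathcal{G}_1$ with likelihood ratio $\hat l=\hat g_1/\hat g_0$ is SMR if $G_0[\hat l<t]\ge\hat G_0[\hat l<t]$ and $G_1[\hat l<t]\le\hat G_1[\hat l<t]$ for all $t\in\mathbb{R}$ and all $(G_0,G_1)\in\mathcal{G}_0\times\mathcal{G}_1$. Finite-sample minimax robustness (FMR): a test is FMR if it is SMR for every sample size $n<\infty$. That is, an FMR test exists for $\mathcal{G}_0,\mathcal{G}_1$ if there is a pair $(\hat G_0,\hat G_1)\in\mathcal{G}_0\times\mathcal{G}_1$ such that for every $n\ge1$ the SMR inequalities hold for $n$ independent observations, with $\hat l$ replaced by $\prod_{k=1}^n\hat l(x_k)$ and $G_j,\hat G_j$ replaced by their $n$-fold products. In particular (case $n=1$) such a pair is SMR. *)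

(* Defs.v *)
From HB Require Import structures.
From mathcomp Require Import all_boot all_order all_algebra.
From mathcomp Require Import all_classical all_reals all_analysis.

Set Implicit Arguments.
Unset Strict Implicit.
Unset Printing Implicit Defensive.

Import Order.TTheory GRing.Theory Num.Theory.
Import numFieldNormedType.Exports.

Local Open Scope classical_set_scope.
Local Open Scope ring_scope.

Section Robustness.
Context {R : realType}.

(* decimal [:: d1; d2; ...] is the real number 0.d1d2...; numerals are unary
   in ring_scope, so long ones have to be given digit by digit. *)
Definition decimal (ds : seq nat) : R :=
  foldr (fun d x => (d%:R + x) / 10) 0 ds.

Section FiniteSpace.
Variable m : nat.

(* The sample space is 'I_m with counting measure; a probability measure is
   identified with its probability vector. *)
Notation vec := 'rV[R]_m.

Definition is_density (g : vec) : Prop :=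
  (forall i, 0 <= g 0 i) /\ \sum_i g 0 i = 1.

(* Since x / 0 = 0, the condition 0 < a forces every g0 and g1 to be
   everywhere positive, so no ratio below has a zero denominator. *)
Definition bounded_likelihood_ratios (A0 A1 : set vec) : Prop :=
  exists a b : R, [/\ 0 < a, a <= b &
    forall g0 g1, A0 g0 -> A1 g1 ->
      forall i, a <= g1 0 i / g0 0 i <= b].

Definition chernoff_functional (u : R) (g0 g1 : vec) : R :=
  \sum_i (g1 0 i `^ u * g0 0 i `^ (1 - u)).

Definition fdiv (f : R -> R) (g0 g1 : vec) : R :=
  \sum_i (f (g1 0 i / g0 0 i) * g0 0 i).

Definition maximizes (D : vec -> vec -> R) (A0 A1 : set vec) (h0 h1 : vec) :
    Prop :=
  [/\ A0 h0, A1 h1 &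
    forall g0 g1, A0 g0 -> A1 g1 -> D g0 g1 <= D h0 h1].

Definition minimizes (D : vec -> vec -> R) (A0 A1 : set vec) (h0 h1 : vec) :
    Prop :=
  [/\ A0 h0, A1 h1 &
    forall g0 g1, A0 g0 -> A1 g1 -> D h0 h1 <= D g0 g1].

(* G^n [ \prod_k l(x_k) < t ], with G^n the n-fold product of the measure of
   density g, and l = h1 / h0. *)
Definition prob_lr_lt (n : nat) (h0 h1 : vec) (t : R) (g : vec) : R :=
  \sum_(x : {ffun 'I_n -> 'I_m} | \prod_k (h1 0 (x k) / h0 0 (x k)) < t)
    \prod_k g 0 (x k).

(* Minimax robustness for n independent observations; SMR is n = 1. *)
Definition minimax_robust (n : nat) (A0 A1 : set vec) (h0 h1 : vec) : Prop :=
  [/\ A0 h0, A1 h1 &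
    forall t g0 g1, A0 g0 -> A1 g1 ->
      prob_lr_lt n h0 h1 t h0 <= prob_lr_lt n h0 h1 t g0 /\
      prob_lr_lt n h0 h1 t g1 <= prob_lr_lt n h0 h1 t h1].

Definition FMR_exists (A0 A1 : set vec) : Prop :=
  exists h0 h1 : vec,
    [/\ A0 h0, A1 h1 &
      forall n, (1 <= n)%N -> minimax_robust n A0 A1 h0 h1].

End FiniteSpace.

Definition vec3 (x y z : R) : 'rV[R]_3 := \row_i nth 0 [:: x; y; z] i.

Definition g0_ex : 'rV[R]_3 :=
  vec3 (decimal [:: 4; 0; 1; 9; 4; 4; 0; 7])
       (decimal [:: 4; 7; 8; 7; 1; 6; 7; 7])
       (decimal [:: 1; 1; 9; 3; 3; 9; 1; 6]).

Definition g1_ex : 'rV[R]_3 :=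
  vec3 (decimal [:: 0; 7; 5; 5; 0; 9; 7; 7])
       (decimal [:: 6; 7; 2; 7; 4; 5; 3; 0])
       (decimal [:: 2; 5; 1; 7; 4; 4; 9; 3]).

Definition hinge (x : R) : R :=
  Num.max (x - (1 + decimal [:: 4; 3; 4; 4; 8])) 0.

End Robustness.

(* Main.v *)
Require Import Defs.
From HB Require Import structures.
From mathcomp Require Import all_boot all_order all_algebra.
From mathcomp Require Import all_classical all_reals all_analysis.
From mathcomp Require Import ring lra.
Import Order.TTheory GRing.Theory Num.Theory.
Import numFieldNormedType.Exports.
Local Open Scope classical_set_scope.
Local Open Scope ring_scope.

(** The set [A0] is the singleton [{g0}] and [A1] is a short segment starting
    at [g1] in the direction [(-1, 2, -1)].  Since [x ^ u] is concave, [g1]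
    maximizes the Chernoff functional on the segment as soon as its derivative
    at [g1] is nonpositive, that is, as soon as [w1 + w3 >= 2 * w2] for the
    weights [wi = (g0i / g1i) ^ (1 - u)].  Here [g0_2 <= g1_2], so [w2 <= 1],
    whereas [g0_1 * g0_3 >= g1_1 * g1_3], so [w1 * w3 >= 1] and
    [w1 + w3 >= 2].  Near [g1] the hinge divergence only sees the third
    coordinate, which decreases along the segment.  Finally, every likelihood
    ratio is increasing in the outcome, so a minimax robust [h1] would have the
    largest first coordinate, which forces [h1 = g1], and the smallest third
    coordinate, which forces the other endpoint. *)

(** * Segments of row vectors *)

Section Segment.
Context {R : realType} {m : nat}.
Implicit Types (b d : 'rV[R]_m) (e : R).

Definition segment b d e : set 'rV[R]_m :=
  [set b + t *: d | t in `[0, e]].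

Lemma segment_base b d e : 0 <= e -> segment b d e b.
Proof. by move=> e0; exists 0; rewrite /= ?in_itv /= ?lexx // scale0r addr0. Qed.

Lemma segment_end b d e : 0 <= e -> segment b d e (b + e *: d).
Proof. by move=> e0; exists e => //; rewrite /= in_itv /= e0 lexx. Qed.

Lemma compact_segment b d e : compact (segment b d e).
Proof.
apply: continuous_compact; last exact: segment_compact.
apply: continuous_subspaceT => t.
by apply: cvgD; [exact: cvg_cst|exact: scalel_continuous].
Qed.

Lemma convex_segment b d e : convex_set (segment b d e).
Proof.
move=> x y l; rewrite !inE => -[s + <-] [t + <-].
rewrite /= !in_itv /= => /andP[s0 se] /andP[t0 te].
have l0 : 0 <= l%:num by [].
have l1 : l%:num <= 1 by [].
exists (l%:num * s + (1 - l%:num) * t).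
  by rewrite /= in_itv /=; apply/andP; split; nra.
rewrite /conv /= /conv /unstable.onem.
by apply/rowP => i; rewrite !mxE; ring.
Qed.

End Segment.

(** * Tangent bounds for powers and the Chernoff functional *)

Section Tangent.
Context {R : realType}.

(** Bernoulli's inequality. With [y = ln x], apply [1 + z <= expR z] at [z = (1 - u) * y] and
    [z = - (u * y)]; weighting the two bounds by [u] and [1 - u] cancels the terms in [y]. *)
Lemma powR_le_tangent1 (u x : R) :
  0 < u < 1 -> 0 < x -> x `^ u <= 1 + u * (x - 1).
Proof.
move=> /andP[u0 u1] x0.
rewrite /powR gt_eqF//; set y := ln x.
have -> : x = expR y by rewrite lnK// posrE.
have E : expR y = expR (u * y) * expR ((1 - u) * y) 
  by rewrite -expRD -mulrDl subrKC mul1r.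
have h0 : 0 < expR (u * y) by exact: expR_gt0.
have h1 : 1 + (1 - u) * y <= expR ((1 - u) * y) by exact: expR_ge1Dx.
have h2 : 1 + - (u * y) <= expR (- (u * y)) by exact: expR_ge1Dx.
have h3 : expR (u * y) * expR (- (u * y)) = 1 by rewrite -expRD subrr expR0.
have h4 : expR (u * y) * (1 - u * y) <= 1 by rewrite -[leRHS]h3 ler_pM2l.
have h5 : expR (u * y) * (1 + (1 - u) * y) <= expR y by rewrite E ler_pM2l.
have h6 := ler_wpM2l (ltW u0) h5.
have h7 : 0 <= 1 - u by rewrite subr_ge0 ltW.
have h8 := ler_wpM2l h7 h4.
lra.
Qed.

Lemma powR_le_tangent (u x y : R) : 0 < u < 1 -> 0 < x -> 0 < y ->
  x `^ u <= y `^ u * (1 + u * (x / y - 1)).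
Proof.
move=> u01 x0 y0.
have -> : x `^ u = y `^ u * (x / y) `^ u.
  by rewrite -powRM ?divr_ge0 ?ltW// mulrC divfK ?gt_eqF.
by rewrite ler_wpM2l ?powR_ge0// powR_le_tangent1// divr_gt0.
Qed.

(** Up to the factor [u], the sum in the last hypothesis is the derivative of the functional at [h1]
    in the direction [g1 - h1]; concavity puts each term below its tangent. *)
Lemma chernoff_functional_le {m : nat} (u : R) (g0 g1 h1 : 'rV[R]_m) :
  0 < u < 1 ->
  (forall i, 0 < g0 0 i) -> (forall i, 0 < g1 0 i) -> (forall i, 0 < h1 0 i) ->
  \sum_i (g0 0 i / h1 0 i) `^ (1 - u) * (g1 0 i - h1 0 i) <= 0 ->
  chernoff_functional u g0 g1 <= chernoff_functional u g0 h1.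
Proof.
move=> u01 g0P g1P h1P slope.
have /andP[u0 u1] := u01.
rewrite -subr_ge0 -oppr_le0 opprB -sumrB.
apply: (@le_trans _ _ (\sum_i u * ((g0 0 i / h1 0 i) `^ (1 - u) *
  (g1 0 i - h1 0 i)))); last by rewrite -mulr_sumr pmulr_rle0.
apply: ler_sum => i _.
have hi := h1P i; have hi0 := lt0r_neq0 hi.
(* This form of the weight has the same two powers as the tangent bound, so only field arithmetic
   remains. *)
have -> : (g0 0 i / h1 0 i) `^ (1 - u) = h1 0 i `^ u * g0 0 i `^ (1 - u) / h1 0 i.
  have hE : h1 0 i = h1 0 i `^ u * h1 0 i `^ (1 - u).
    by rewrite -powRD ?subrKC ?powRr1 ?hi0 ?implybT// ltW.
  apply: (mulIf hi0); rewrite divfK// [X in _ * X = _]hE mulrCA.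
  by rewrite -powRM ?divr_ge0 ?ltW// divfK.
have := powR_le_tangent u (g1 0 i) (h1 0 i) u01 (g1P i) hi.
move=> /(ler_wpM2r (powR_ge0 (g0 0 i) (1 - u))) H.
rewrite lerBlDr; apply: (le_trans H).
by rewrite le_eqVlt; apply/orP; left; apply/eqP; field.
Qed.

Lemma prob_lr_lt1 {m : nat} (h0 h1 g : 'rV[R]_m) (t : R) :
  prob_lr_lt 1 h0 h1 t g = \sum_(i | h1 0 i / h0 0 i < t) g 0 i.
Proof.
rewrite /prob_lr_lt (reindex (fun i : 'I_m => [ffun=> i] : {ffun 'I_1 -> 'I_m})) /=.
  apply: eq_big => [i|i _]; first by rewrite big_ord1 ffunE.
  by rewrite big_ord1 ffunE.
exists (fun x : {ffun 'I_1 -> 'I_m} => x 0) => [i _|x _]; first by rewrite ffunE.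
by apply/ffunP => j; rewrite ffunE (ord1 j).
Qed.

End Tangent.

(** * The explicit vectors and the segment *)

Section Example.
Context {R : realType}.

Lemma sum_vec3 (F : 'I_3 -> R) : \sum_i F i = F 0 + F 1 + F 2.
Proof.
rewrite !big_ord_recl big_ord0 addr0 addrA.
by congr (F _ + F _ + F _); exact/val_inj.
Qed.

Lemma forall_ord3 (P : 'I_3 -> Prop) : P 0 -> P 1 -> P 2 -> forall i, P i.
Proof.
move=> P0 P1 P2 [[|[|[|//]]] Hi].
- by rewrite (_ : Ordinal Hi = 0)//; exact/val_inj.
- by rewrite (_ : Ordinal Hi = 1)//; exact/val_inj.
- by rewrite (_ : Ordinal Hi = 2)//; exact/val_inj.
Qed.

Lemma vec3E (x y z : R) :
  (vec3 x y z 0 0 = x) * (vec3 x y z 0 1 = y) * (vec3 x y z 0 2 = z).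
Proof. by rewrite !mxE. Qed.

Lemma g0_ex_bounds :
  [/\ 4 / 10 < g0_ex 0 0 :> R, g0_ex 0 0 < 41 / 100 :> R,
      47 / 100 < g0_ex 0 1 :> R, g0_ex 0 1 < 48 / 100 :> R &
      11 / 100 < g0_ex 0 2 :> R /\ g0_ex 0 2 < 12 / 100 :> R].
Proof. by rewrite !vec3E /decimal /=; do !split; lra. Qed.

Lemma g0_ex_sum : \sum_i g0_ex 0 i = 1 :> R.
Proof. rewrite sum_vec3 !vec3E /decimal /=; lra. Qed.

Lemma g1_ex_sum : \sum_i g1_ex 0 i = 1 :> R.
Proof. rewrite sum_vec3 !vec3E /decimal /=; lra. Qed.

Definition direction : 'rV[R]_3 := vec3 (-1) 2 (-1).

(* The length [1 / 1000] keeps the second likelihood ratio below [1.43448]. *)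
Definition A1_ex : set 'rV[R]_3 := segment g1_ex direction (1 / 1000).

Lemma A1_ex_entries (t : R) :
  ((g1_ex + t *: direction) 0 0 = g1_ex 0 0 - t) *
  ((g1_ex + t *: direction) 0 1 = g1_ex 0 1 + 2 * t) *
  ((g1_ex + t *: direction) 0 2 = g1_ex 0 2 - t).
Proof.
by do !split; rewrite mxE [X in _ + X = _]mxE [direction _ _]mxE /=; ring.
Qed.

Lemma A1_exP (g : 'rV[R]_3) : A1_ex g ->
  exists t, [/\ 0 <= t, t <= 1 / 1000, g 0 0 = g1_ex 0 0 - t,
    g 0 1 = g1_ex 0 1 + 2 * t & g 0 2 = g1_ex 0 2 - t].
Proof.
move=> [t + <-]; rewrite /= in_itv /= => /andP[t0 t1]; exists t.
by rewrite !A1_ex_entries.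
Qed.

Lemma A1_ex_bounds (g : 'rV[R]_3) : A1_ex g ->
  [/\ 7 / 100 < g 0 0, g 0 0 < 8 / 100,
      67 / 100 < g 0 1, g 0 1 < 68 / 100 &
      25 / 100 < g 0 2 /\ g 0 2 < 26 / 100].
Proof.
move=> /A1_exP[t [t0 t1 -> -> ->]].
by rewrite !vec3E /decimal /=; do !split; lra.
Qed.

Lemma A1_ex_density (g : 'rV[R]_3) : A1_ex g -> is_density g.
Proof.
move=> Ag; have [? ? ? ? [? ?]] := A1_ex_bounds _ Ag; split.
  by apply: forall_ord3; lra.
have [t [_ _ E0 E1 E2]] := A1_exP _ Ag.
have := g1_ex_sum; rewrite !sum_vec3 E0 E1 E2; lra.
Qed.

Lemma g0_ex_gt0 i : 0 < g0_ex 0 i :> R.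
Proof.
have [? ? ? ? [? ?]] := g0_ex_bounds.
by move: i; apply: forall_ord3; lra.
Qed.

Lemma A1_ex_gt0 (g : 'rV[R]_3) : A1_ex g -> forall i, 0 < g 0 i.
Proof.
move=> /A1_ex_bounds[? ? ? ? [? ?]].
by apply: forall_ord3; lra.
Qed.

Lemma A1_ex_bounded_ratios :
  bounded_likelihood_ratios [set g0_ex] A1_ex.
Proof.
(* The smallest ratio exceeds 0.07 / 0.41 and the largest is below 0.26 / 0.11. *)
exists (1 / 10), 3; split; [lra|lra|move=> g0 g1 -> Ag i].
rewrite ler_pdivlMr ?ler_pdivrMr ?g0_ex_gt0//.
have [? ? ? ? [? ?]] := A1_ex_bounds _ Ag.
have [? ? ? ? [? ?]] := g0_ex_bounds.
by move: i; apply: forall_ord3; apply/andP; split; lra.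
Qed.

Lemma A1_ex_chernoff (u : R) (g : 'rV[R]_3) : 0 < u < 1 -> A1_ex g ->
  chernoff_functional u g0_ex g <= chernoff_functional u g0_ex g1_ex.
Proof.
move=> u01 Ag; have /andP[u0 u1] := u01.
have A1g : A1_ex g1_ex by apply: segment_base; lra.
have h1P := A1_ex_gt0 _ A1g.
apply: chernoff_functional_le => //; [exact: g0_ex_gt0|exact: A1_ex_gt0|].
have [t [t0 _ E0 E1 E2]] := A1_exP _ Ag.
have aP i : 0 < g0_ex 0 i / g1_ex 0 i :> R by rewrite divr_gt0 ?g0_ex_gt0.
have s0 : 0 <= 1 - u by lra.
have [? ? ? ? [? ?]] := g0_ex_bounds.
have [? ? ? ? [? ?]] := A1_ex_bounds _ A1g.
have p1 : 1 `^ (1 - u) = 1 :> R by rewrite powR1.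
have w1 : (g0_ex 0 1 / g1_ex 0 1) `^ (1 - u) <= 1 :> R.
  rewrite -[leRHS]p1.
  apply: ge0_ler_powR; rewrite ?nnegrE// ?ltW//.
  by rewrite ltr_pdivrMr// mul1r; lra.
have w02 : 1 <= (g0_ex 0 0 / g1_ex 0 0) `^ (1 - u) *
    (g0_ex 0 2 / g1_ex 0 2) `^ (1 - u) :> R.
  (* The coarse bounds suffice: 0.4 * 0.11 > 0.08 * 0.26. *)
  have a02 : 1 <= g0_ex 0 0 / g1_ex 0 0 * (g0_ex 0 2 / g1_ex 0 2) :> R.
    by rewrite mulf_div ler_pdivlMr ?mulr_gt0// mul1r; nra.
  rewrite -powRM ?(ltW (aP _))// -[leLHS]p1.
  by apply: ge0_ler_powR; rewrite ?nnegrE// (le_trans ler01 a02).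
have w0P : 0 < (g0_ex 0 0 / g1_ex 0 0) `^ (1 - u) :> R by exact: powR_gt0.
have w2P : 0 < (g0_ex 0 2 / g1_ex 0 2) `^ (1 - u) :> R by exact: powR_gt0.
rewrite sum_vec3 E0 E1 E2.
set w := (_ / g1_ex 0 0) `^ _ in w02 w0P *.
set w' := (_ / g1_ex 0 2) `^ _ in w02 w2P *.
set v := (_ / _) `^ _ in w1 *.
(* AM-GM: [w * (w + w') >= w ^ 2 + 1 >= 2 * w]. *)
have ww' : 2 <= w + w'.
  rewrite -(ler_pM2l w0P).
  by have := sqr_ge0 (w - 1); lra.
(* This product is the slope with its sign changed. *)
have : 0 <= t * (w + w' - 2 * v) by apply: mulr_ge0 => //; lra.
by lra.
Qed.

Lemma hinge_mul (x y : R) : 0 < y ->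
  hinge (x / y) * y = Num.max (x - (1 + decimal [:: 4; 3; 4; 4; 8]) * y) 0.
Proof.
by move=> y0; rewrite /hinge maxr_pMl ?ltW// mul0r mulrBl divfK ?gt_eqF.
Qed.

Lemma A1_ex_hinge (g : 'rV[R]_3) : A1_ex g ->
  fdiv hinge g0_ex g =
  g 0 2 - (1 + decimal [:: 4; 3; 4; 4; 8]) * g0_ex 0 2.
Proof.
move=> Ag; rewrite /fdiv sum_vec3 !hinge_mul ?g0_ex_gt0//.
set c := 1 + _.
have [c0 c1] : 143 / 100 < c /\ c < 144 / 100.
  by rewrite /c /decimal /=; split; lra.
have [? ? ? ? [? ?]] := A1_ex_bounds _ Ag.
have [? ? ? ? [? ?]] := g0_ex_bounds.
(* The bound 0.47 is too coarse for the second term to vanish: 1.43 * 0.47 < 0.68 < 1.43 * 0.478. *)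
have ? : 478 / 1000 < g0_ex 0 1 :> R by rewrite !vec3E /decimal /=; lra.
rewrite max_r; last by nra.
rewrite max_r; last by nra.
rewrite max_l; last by nra.
by rewrite !add0r.
Qed.

Lemma prob_lr_lt1_ord3 (h0 h1 g : 'rV[R]_3) (t : R) :
  prob_lr_lt 1 h0 h1 t g = (if h1 0 0 / h0 0 0 < t then g 0 0 else 0) +
    (if h1 0 1 / h0 0 1 < t then g 0 1 else 0) +
    (if h1 0 2 / h0 0 2 < t then g 0 2 else 0).
Proof. by rewrite prob_lr_lt1 big_mkcond sum_vec3. Qed.

Lemma A1_ex_not_SMR (h1 : 'rV[R]_3) :
  ~ minimax_robust 1 [set g0_ex] A1_ex g0_ex h1.
Proof.
move=> [_ Ah rob].
have [? ? ? ? [? ?]] := A1_ex_bounds _ Ah.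
have [? ? ? ? [? ?]] := g0_ex_bounds.
have l01 : h1 0 0 / g0_ex 0 0 < h1 0 1 / g0_ex 0 1.
  by rewrite ltr_pdivrMr ?g0_ex_gt0// mulrAC ltr_pdivlMr ?g0_ex_gt0//; nra.
have l12 : h1 0 1 / g0_ex 0 1 < h1 0 2 / g0_ex 0 2.
  by rewrite ltr_pdivrMr ?g0_ex_gt0// mulrAC ltr_pdivlMr ?g0_ex_gt0//; nra.
have l02 := lt_trans l01 l12.
have e0 : 0 <= 1 / 1000 :> R by lra.
have A1g : A1_ex g1_ex by exact: segment_base.
have Aq : A1_ex (g1_ex + (1 / 1000) *: direction) by exact: segment_end.
have [t [t0 t1 E0 E1 E2]] := A1_exP _ Ah.
(* The inequality [< t] is strict, so this threshold selects the first outcome alone; comparison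
   with [g1_ex] gives [t <= 0]. *)
have [_] := rob (h1 0 1 / g0_ex 0 1) _ _ erefl A1g.
rewrite !prob_lr_lt1_ord3.
rewrite l01 ltxx (lt_gtF l12) !addr0 E0 => H0.
(* Now the first two outcomes are selected. Their mass grows by [t] along the segment, so the far
   endpoint forces [t >= 1 / 1000]. *)
have [_] := rob (h1 0 2 / g0_ex 0 2) _ _ erefl Aq.
rewrite !prob_lr_lt1_ord3.
by rewrite l02 l12 ltxx !addr0 E0 E1 !A1_ex_entries; lra.
Qed.

End Example.

Theorem mainTheorem1 (R : realType) :
  exists A0 A1 : set 'rV[R]_3,
    [/\ (forall g, A0 g -> is_density g) /\ (forall g, A1 g -> is_density g),
        convex_set A0 /\ convex_set A1,
        compact A0 /\ compact A1,
        A0 `&` A1 = set0 &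
        [/\ A0 g0_ex, A1 g1_ex & bounded_likelihood_ratios A0 A1]] /\
    [/\ (forall u : R, 0 < u < 1 ->
           maximizes (chernoff_functional u) A0 A1 g0_ex g1_ex),
        ~ minimizes (fdiv hinge) A0 A1 g0_ex g1_ex &
        ~ FMR_exists A0 A1].
Proof.
have A1g : A1_ex (g1_ex : 'rV[R]_3) by apply: segment_base; lra.
exists [set g0_ex], A1_ex; split; split.
- split; last exact: A1_ex_density.
  by move=> g ->; split=> [i|]; [exact/ltW/g0_ex_gt0|exact: g0_ex_sum].
- split; last exact: convex_segment.
  move=> x y l; rewrite !inE => -> ->; rewrite /= /conv /= /conv.
  by rewrite -scalerDl /unstable.onem subrKC scale1r.
- by split; [exact: compact_set1|exact: compact_segment].
- rewrite -subset0 => g [-> /A1_ex_bounds[_ ? _ _ _]].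
  by have [? _ _ _ _] := @g0_ex_bounds R; lra.
- by split=> //; exact: A1_ex_bounded_ratios.
- by move=> u u01; split=> // g0 g1 -> ?; exact: A1_ex_chernoff.
(* The far endpoint lowers the divergence by exactly 1 / 1000. *)
- move=> [_ _ /(_ g0_ex (g1_ex + (1 / 1000) *: direction) erefl)].
  have Aq : A1_ex (g1_ex + (1 / 1000) *: direction : 'rV[R]_3).
    by apply: segment_end; lra.
  by move=> /(_ Aq); rewrite !A1_ex_hinge// A1_ex_entries; lra.
- by move=> [h0 [h1 [-> _ /(_ 1%N isT)]]]; exact: A1_ex_not_SMR.
Qed.
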